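(* For every nonempty finite set $S \subset \mathbb{Z}^+$, there exist infinitely many graphs which are chordal and Hamiltonian but not $S$-cycle extendible.
   Context: All graphs are simple, finite, connected and undirected. A graph is chordal if it has no induced cycle of length at least $4$. For a finite set $S \subset \mathbb{Z}^+$, a cycle $C$ of a graph $G$ is $S$-extendible if there is a cycle $C'$ in $G$ with $V(C) \subset V(C')$ and $|V(C')| - |V(C)| \in S$. A graph $G$ is $S$-cycle extendible if every cycle of $G$ that could be $S$-extendible (i.e. every cycle $C$ with $|V(C)| + s \leq |V(G)|$ for some $s \in S$) is $S$-extendible. *)

(* Defs.v *)
From mathcomp Require Import all_boot finmap.

Set Implicit Arguments.
Unset Strict Implicit.
Unset Printing Implicit Defensive.

Record sgraph := SGraph {
  vertex :> finType;
  edge : rel vertex;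
  edge_sym : symmetric edge;
  edge_irrefl : irreflexive edge }.

Definition isomorphic (G H : sgraph) : Prop :=
  exists2 f : G -> H, bijective f & forall x y, edge (f x) (f y) = edge x y.

Section Cycles.

Variable G : sgraph.
Implicit Types c : seq G.

Definition connected_graph : Prop := forall x y : G, connect (@edge G) x y.

(* A cycle is listed by its vertices in cyclic order.  The size bound is needed
   because [ucycle] also accepts the empty sequence and a single edge [x; y]. *)
Definition is_cycle c : Prop := ucycle (@edge G) c /\ 3 <= size c.

Definition cycle_vertices c : {set G} := [set x in c].

(* No chords: adjacent vertices of c are consecutive along c. *)
Definition is_induced_cycle c : Prop :=
  is_cycle c /\
  forall x y, x \in c -> y \in c -> edge x y -> y = next c x \/ x = next c y.

Definition chordal : Prop := ~ exists2 c, is_induced_cycle c & 4 <= size c.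

Definition hamiltonian : Prop :=
  exists2 c, is_cycle c & cycle_vertices c = [set: G].

Definition cycle_S_extendible (S : {fset nat}) c : Prop :=
  exists c', [/\ is_cycle c',
    cycle_vertices c \proper cycle_vertices c' &
    #|cycle_vertices c'| - #|cycle_vertices c| \in S].

Definition S_cycle_extendible (S : {fset nat}) : Prop :=
  forall c, is_cycle c ->
    (exists2 s, s \in S & #|cycle_vertices c| + s <= #|G|) ->
    cycle_S_extendible S c.

End Cycles.

(* Main.v *)
Require Import Defs.
From mathcomp Require Import all_boot finmap.
From mathcomp Require Import zify.

Set Implicit Arguments.
Unset Strict Implicit.
Unset Printing Implicit Defensive.

(** Take a chordal graph made of a clique [{w, u1, u2}] joined to a path and a
    triangle sharing an end of the path, and attach to five edges a vertex of
    degree 2: every cycle through these five vertices contains the five detours of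
    length 2, which already saturate [u1] and [u2].  The graph has a Hamiltonian
    cycle that runs along the path, and a cycle that avoids [K] consecutive inner
    vertices of the path.  A longer cycle can leave the path only through [w],
    which has one free place left, and doing so closes the cycle up too early
    ([w], the rest of the path, and back to [w]); hence it contains all [K]
    vertices.  Taking [K] larger than every element of [S] gives the result, and
    different [K] give graphs of different orders. *)

(** * Neighbours along a cycle, and a criterion for chordality *)

Section CycleNeighbours.

Variables (G : sgraph) (c : seq G).
Hypothesis cyc : is_cycle c.

Let cU : uniq c. Proof. by case: cyc => /andP[]. Qed.
Let cC : cycle (@edge G) c. Proof. by case: cyc => /andP[]. Qed.

Definition cycle_adj (x y : G) : bool :=
  (x \in c) && ((y == next c x) || (y == prev c x)).

Lemma cycle_adjP x y : cycle_adj x y -> [/\ x \in c, y \in c & edge x y].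
Proof.
case/andP=> xc /orP[]/eqP->; split; rewrite ?mem_next ?mem_prev //.
  exact: next_cycle cC xc.
by rewrite edge_sym; apply: prev_cycle cC xc.
Qed.

Lemma cycle_adj_sym x y : cycle_adj x y -> cycle_adj y x.
Proof.
move=> xy; have [_ yc _] := cycle_adjP xy; move: xy; rewrite /cycle_adj yc.
by case/andP=> _ /orP[]/eqP->; rewrite ?(prev_next cU) ?(next_prev cU) eqxx ?orbT.
Qed.

Lemma next_neq_prev x : x \in c -> next c x <> prev c x.
Proof.
move=> xc eqnp; have : next c (next c x) = x by rewrite eqnp next_prev.
have [i s def_c] := rot_to xc; have [_ sz_c] := cyc.
rewrite -!(next_rot i cU); move: sz_c cU; rewrite -(size_rot i) -(rot_uniq i) def_c.
case: s {def_c} => [|y [|z s]] //= _.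
rewrite !inE !negb_or -!andbA !eqxx => /and4P[xy xz _ _].
by rewrite (eq_sym y x) (negbTE xy) => ezx; rewrite ezx eqxx in xz.
Qed.

Lemma cycle_adj_two x : x \in c ->
  exists y z, [/\ y <> z, cycle_adj x y, cycle_adj x z
    & forall t, cycle_adj x t -> t = y \/ t = z].
Proof.
move=> xc; exists (next c x), (prev c x); rewrite /cycle_adj xc !eqxx orbT.
split=> // [|t /orP[]/eqP]; [exact: next_neq_prev | by left | by right].
Qed.

(** Connectedness of a cycle as an induction principle: iterating [next c] from [x] reaches every
    vertex of [c]. *)
Lemma cycle_adj_closed (Q : G -> Prop) x :
  x \in c -> Q x -> (forall y z, Q y -> cycle_adj y z -> Q z) ->
  forall y, y \in c -> Q y.
Proof.
move=> xc Qx Qcl y yc.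
have : fconnect (next c) x y by rewrite (fconnect_cycle (cycle_next cU)).
move/iter_findex<-; elim: findex => [|k IH] //=; apply: Qcl IH _.
rewrite /cycle_adj eqxx andbT.
by elim: k => //= k; rewrite mem_next.
Qed.

End CycleNeighbours.

(* In an induced cycle the vertex of largest rank would have two adjacent
   neighbours, hence a chord unless the cycle is a triangle. *)
Lemma simplicial_order_chordal (G : sgraph) (rank : G -> nat) :
  injective rank ->
  (forall x y z, edge x z -> edge y z -> x <> y ->
    rank x < rank z -> rank y < rank z -> edge x y) ->
  chordal G.
Proof.
move=> rank_inj simp [c [cyc ind] sz_c].
have cU : uniq c by case: cyc => /andP[].
case: c cyc ind sz_c cU => // x0 c'; set c := x0 :: c' => cyc ind sz_c cU.
have x0c : x0 \in c by rewrite mem_head.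
case: (arg_maxnP rank x0c) => x x_in rmax; have xc : x \in c := x_in.
have lt_rank y : cycle_adj c x y -> rank y < rank x.
  move=> xy; have [_ yc exy] := cycle_adjP cyc xy.
  rewrite ltn_neqAle [rank y <= _]rmax // andbT.
  by apply/eqP=> /rank_inj eyx; rewrite eyx edge_irrefl in exy.
have xn : cycle_adj c x (next c x) by rewrite /cycle_adj xc eqxx.
have xp : cycle_adj c x (prev c x) by rewrite /cycle_adj xc eqxx orbT.
have [_ nc en] := cycle_adjP cyc xn; have [_ pc ep] := cycle_adjP cyc xp.
have npp := next_neq_prev cyc xc.
have enp : edge (next c x) (prev c x).
  by apply: simp (lt_rank _ xn) (lt_rank _ xp); rewrite // edge_sym.
case: (ind _ _ nc pc enp); last first.
  by rewrite next_prev // => enx; rewrite enx edge_irrefl in en.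
(* Three steps along [c] lead back to [x], so [c] has length 3, against [sz_c]. *)
have [i s def_c] := rot_to xc => eq3.
have : next c (next c (next c x)) = x by rewrite -eq3 next_prev.
rewrite -!(next_rot i cU); move: sz_c cU; rewrite -(size_rot i) -(rot_uniq i) def_c.
case: s {def_c} => [|a [|b [|d s]]] //= _.
rewrite !inE !negb_or -!andbA eqxx.
case/and5P=> xa xb xd xs /and5P[ab ad as_ bd /andP[bs _]].
rewrite (eq_sym a x) (negbTE xa) eqxx (eq_sym b x) (negbTE xb) (eq_sym b a).
by rewrite (negbTE ab) eqxx => edx; rewrite edx eqxx in xd.
Qed.

(* Here [w, u1, u2] are [0, 1, 2], the triangle is [3, 4, 5], the path is
   [5, 6, .., K + 7], whose vertices in [6, K + 5] are those avoided by the short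
   cycle, and [K + 8, .., K + 12] are the vertices of degree 2. *)
Definition half_edge (K i j : nat) : bool :=
  [|| (i < 3) && (i < j < K + 8),
      [&& 3 <= i, j < K + 8 & (j == i.+1) || (i == 3) && (j == 5)],
      (j == K + 8) && ((i == 1) || (i == K + 7)),
      (j == K + 9) && ((i == 1) || (i == 3)),
      (j == K + 10) && ((i == 2) || (i == K + 6)),
      (j == K + 11) && ((i == 2) || (i == 4))
    | (j == K + 12) && ((i == 0) || (i == 5))].

Lemma half_edge_lt K i j : half_edge K i j -> i < j.
Proof.
by case/or4P=> [||| /or4P[]] H; lia.
Qed.

Definition nat_edge K i j := half_edge K i j || half_edge K j i.

Definition ord_edge K : rel 'I_(K + 13) := fun i j => nat_edge K i j.

Lemma ord_edge_sym K : symmetric (@ord_edge K).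
Proof. by move=> i j; rewrite /ord_edge /nat_edge orbC. Qed.

Lemma ord_edge_irrefl K : irreflexive (@ord_edge K).
Proof. move=> i; rewrite /ord_edge /nat_edge orbb.
by apply/negP=> /half_edge_lt; rewrite ltnn. Qed.

Definition gap_graph K : sgraph := SGraph (@ord_edge_sym K) (@ord_edge_irrefl K).

(** The numbering is a perfect elimination order read backwards. A degree-2 vertex is attached to
    the ends of an edge, and a path vertex only sees its predecessor and the clique below it. As [j]
    is the lower end of an edge, [j < K + 8], so only the first two kinds of edge can join [i] to
    [j]. *)
Lemma half_edge_clique K i j k :
  half_edge K i k -> half_edge K j k -> i < j -> half_edge K i j.
Proof.
move=> ik jk ij.
suff : [|| (i < 3) && (i < j < K + 8) |
      [&& 3 <= i, j < K + 8 & (j == i.+1) || (i == 3) && (j == 5)]].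
  by rewrite /half_edge; case/orP=> ->; rewrite ?orbT.
by case/or4P: ik => [||| /or4P[]] Hi; case/or4P: jk => [||| /or4P[]] Hj; lia.
Qed.

Lemma gap_graph_chordal K : chordal (gap_graph K).
Proof.
apply: (@simplicial_order_chordal (gap_graph K) (@nat_of_ord _)) => [|x y z].
  exact: val_inj.
have half (i j : 'I_(K + 13)) :
    @edge (gap_graph K) i j -> i < j -> half_edge K i j.
  by case/orP=> // /half_edge_lt ji ij; move: (ltn_trans ij ji); rewrite ltnn.
move=> xz yz xy /(half _ _ xz) {}xz /(half _ _ yz) {}yz; apply/orP.
case: (ltngtP x y) => [lt_xy|lt_yx|/val_inj //].
  by left; apply: half_edge_clique xz yz lt_xy.
by right; apply: half_edge_clique yz xz lt_yx.
Qed.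

(** * Two explicit cycles *)

Lemma gap_graph_cycle K (s : seq nat) :
  all (fun i => i < K + 13) s -> uniq s -> cycle (nat_edge K) s -> 3 <= size s ->
  exists2 c : seq (gap_graph K), is_cycle c & map (@nat_of_ord _) c = s.
Proof.
move=> ltK sU sC sz_s.
have [c def_s] : exists c : seq 'I_(K + 13), map (@nat_of_ord _) c = s.
  elim: s ltK {sU sC sz_s} => [|i s IH] /=; first by exists [::].
  by case/andP=> lti /IH[c <-]; exists (Ordinal lti :: c).
exists c => //; split; last by rewrite -(size_map (@nat_of_ord _)) def_s.
apply/andP; split; last by rewrite -(map_inj_uniq (@ord_inj _)) def_s.
by move: sC; rewrite -def_s cycle_map.
Qed.

(** Both cycles make all five detours. The long one runs along the path from [5] to [K + 6]; the
    short one jumps over the gap by using the edges [0]-[4], [3]-[5] and [K + 6]-[K + 7] instead. *)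
Definition long_cycle K : seq nat :=
  [:: 0, K + 12 & iota 5 (K + 2)] ++
  [:: K + 10; 2; K + 11; 4; 3; K + 9; 1; K + 8; K + 7].

Definition short_cycle K : seq nat :=
  [:: 0; 4; K + 11; 2; K + 10; K + 6; K + 7; K + 8; 1; K + 9; 3; 5; K + 12].

Lemma nat_edge_path K m n r : 5 <= m -> m + n <= K + 7 ->
  path (nat_edge K) m (iota m.+1 n ++ r) = path (nat_edge K) (m + n) r.
Proof.
elim: n m => [|n IH] m le5m lemK /=; first by rewrite addn0.
rewrite IH ?addSnnS; try lia.
suff -> : nat_edge K m m.+1 by [].
by apply/orP; left; apply/or4P; apply: Or42; lia.
Qed.

Lemma gap_graph_hamiltonian K : hamiltonian (gap_graph K).
Proof.
have [||||c cyc def_c] := @gap_graph_cycle K (long_cycle K).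
- apply/allP=> i; rewrite /long_cycle mem_cat !inE mem_iota; lia.
- rewrite /long_cycle cat_uniq !cons_uniq iota_uniq !inE !mem_iota.
  apply/and3P; split; [by lia | | by rewrite /=; lia].
  by apply/hasPn=> i; rewrite !inE mem_iota; lia.
- rewrite /long_cycle addn2 /= rcons_cat nat_edge_path; try lia.
  by rewrite /= /nat_edge /half_edge; repeat (apply/andP; split); lia.
- by rewrite /long_cycle size_cat /=; lia.
exists c => //; apply/setP=> x; rewrite !inE.
rewrite -(mem_map (@ord_inj _)) def_c /long_cycle mem_cat !inE mem_iota.
by move: (ltn_ord x); lia.
Qed.

Lemma gap_graph_short_cycle K : exists2 c : seq (gap_graph K),
  is_cycle c & map (@nat_of_ord _) c = short_cycle K.
Proof.
apply: gap_graph_cycle; rewrite /short_cycle //=.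
- by repeat (apply/andP; split); lia.
- by rewrite !inE; repeat (apply/andP; split); lia.
- by rewrite /nat_edge /half_edge; repeat (apply/andP; split); lia.
Qed.

(** * A cycle through all vertices outside the gap and one inside it *)

(* Cycles are abstracted here to a vertex set [M] and an adjacency [A] that is
   2-regular and connected on [M], with all vertices replaced by numbers. *)
Section GapFilling.

Variables (K : nat) (M : pred nat) (A : nat -> nat -> Prop).
Hypothesis A_sym : forall i j, A i j -> A j i.
Hypothesis A_edge : forall i j, A i j -> [/\ M i, M j & nat_edge K i j].
Hypothesis A_two : forall i, M i -> exists j k,
  [/\ j <> k, A i j, A i k & forall l, A i l -> l = j \/ l = k].
Hypothesis A_closed : forall (Q : nat -> Prop) i, M i -> Q i ->
  (forall j k, Q j -> A j k -> Q k) -> forall j, M j -> Q j.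
Hypothesis M_short : forall i, i < 6 \/ K + 6 <= i < K + 13 -> M i.

(** 2-regularity is used in two directions: [forced] when only two candidates remain, [saturated]
    once two neighbours are known. *)
Let forced i j k : M i -> (forall l, A i l -> l = j \/ l = k) -> A i j /\ A i k.
Proof.
move=> /A_two[p [q [pq Aip Aiq _]]] only.
by case: (only _ Aip) (only _ Aiq) => ep [] eq; subst.
Qed.

Let saturated i j k l : A i j -> A i k -> j <> k -> A i l -> l = j \/ l = k.
Proof.
move=> Aij; have [/A_two[p [q [pq _ _ only]]] _ _] := A_edge Aij.
by move: (only _ Aij) => + /only + + /only; lia.
Qed.

Let pendant p i j : p < K + 13 -> K + 8 <= p ->
  (forall l, half_edge K l p -> l = i \/ l = j) -> A p i /\ A p j.
Proof.
move=> ltp lep nbrs; apply: forced => [|l /A_edge[_ _ /orP[]]]; last exact: nbrs.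
  by apply: M_short; lia.
by rewrite /half_edge; lia.
Qed.

Let pendants : [/\ A (K + 8) 1 /\ A (K + 8) (K + 7), A (K + 9) 1 /\ A (K + 9) 3,
  A (K + 10) 2 /\ A (K + 10) (K + 6), A (K + 11) 2 /\ A (K + 11) 4
  & A (K + 12) 0 /\ A (K + 12) 5].
Proof. by split; apply: pendant => [||l]; rewrite /half_edge; lia. Qed.

Let nbr1 l : A 1 l -> l = K + 8 \/ l = K + 9.
Proof.
case: pendants => -[/A_sym Aa _] [/A_sym Ab _] _ _ _.
by apply: saturated => //; lia.
Qed.

Let nbr2 l : A 2 l -> l = K + 10 \/ l = K + 11.
Proof.
case: pendants => _ _ [/A_sym Aa _] [/A_sym Ab _] _.
by apply: saturated => //; lia.
Qed.

Let nbr_gap i l : 6 <= i < K + 6 -> A i l -> [\/ l = 0, l = i.-1 | l = i.+1].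
Proof.
move=> gap_i Ail; have [_ _] := A_edge Ail.
have l1 : l <> 1 by move=> el; move: Ail; rewrite el => /A_sym/nbr1; lia.
have l2 : l <> 2 by move=> el; move: Ail; rewrite el => /A_sym/nbr2; lia.
have [->|/eqP l0] := eqVneq l 0; first by move=> _; apply: Or31.
move=> eil; suff [->|->] : l = i.-1 \/ l = i.+1 by [apply: Or32|apply: Or33].
by case/orP: eil => /or4P[||| /or4P[]] H; lia.
Qed.

(** The case split is on the neighbour [q] of [K + 7] other than [K + 8]. Since [1] and [2] are
    saturated, [q] is [0] or [K + 6]; the first choice fills the gap and the second is
    impossible. *)
Lemma gap_filled z : 6 <= z < K + 6 -> M z -> forall i, i < K + 13 -> M i.
Proof.
move=> gap_z Mz.
suff fill i : 6 <= i < K + 6 -> M i.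
  move=> i ltiK; have [gap_i|ngap] := boolP (6 <= i < K + 6); first exact: fill.
  by apply: M_short; lia.
case: pendants => -[_ /A_sym A78] _ [_ /A_sym A610] _ [/A_sym A012 /A_sym A512].
have [q [q8 A7q]] : exists q, q <> K + 8 /\ A (K + 7) q.
  have [/A_two[j [k [jk Aj Ak _]]] _ _] := A_edge A78.
  have [ej|/eqP] := eqVneq j (K + 8); last by exists j.
  by exists k; split=> // ek; lia.
have {q8} [q0|q6] : q = 0 \/ q = K + 6.
  have q1 : q <> 1 by move=> q1; move: A7q; rewrite q1 => /A_sym/nbr1; lia.
  have q2 : q <> 2 by move=> q2; move: A7q; rewrite q2 => /A_sym/nbr2; lia.
  by have [_ _] := A_edge A7q; rewrite /nat_edge /half_edge; lia.
- subst q => gap_i.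
  have nbr0 l : A 0 l -> l = K + 12 \/ l = K + 7.
    by apply: saturated => //; [exact: A_sym | lia].
  (* With [0] saturated by [K + 12] and [K + 7], a gap vertex has only its path neighbours left, so
     membership spreads from [z] both ways. *)
  have step j : 6 <= j < K + 6 -> M j -> A j j.-1 /\ A j j.+1.
    move=> gap_j Mj; apply: forced => // l Ajl.
    case: (nbr_gap gap_j Ajl) => [l0||]; [|by left|by right].
    by subst l; move: (nbr0 _ (A_sym Ajl)); lia.
  have up d : z + d < K + 6 -> M (z + d).
    elim: d => [|d IH] ltd; first by rewrite addn0.
    have [||_] := step (z + d) _ (IH _); try lia.
    by rewrite addnS => /A_edge[].
  have down d : 6 + d <= z -> M (z - d).
    elim: d => [|d IH] led; first by rewrite subn0.
    have [||/A_edge[_ Mj _] _] := step (z - d) _ (IH _); try lia.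
    by rewrite subnS.
  case: (leqP z i) => zi.
    by have := up (i - z); rewrite subnKC //; apply; lia.
  by have := down (z - i); rewrite subKn; [apply; lia | lia].
subst q; exfalso; clear i.
have nbr6 l : A (K + 6) l -> l = K + 10 \/ l = K + 7.
  by apply: saturated => //; [exact: A_sym | lia].
(* The last gap vertex on the cycle is adjacent to [0]; from there the cycle has
   to follow the path down to 5, and [Q] below is a closed proper part of it. *)
have [i /andP[gap_i Mi] imax] : exists2 i, (6 <= i < K + 6) && M i &
    forall j, (6 <= j < K + 6) && M j -> j <= i.
  have [|j|i iP imax] := @ex_maxnP (fun i => (6 <= i < K + 6) && M i) (K + 6).
  - by exists z; rewrite gap_z.
  - by lia.
  - by exists i.
have [Ai0 Aip] : A i 0 /\ A i i.-1.
  apply: forced => // l Ail; case: (nbr_gap gap_i Ail) => [||el]; [by left|by right|].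
  subst l; have [ei|/eqP ni] := eqVneq i.+1 (K + 6).
    by move: Ail; rewrite ei => /A_sym/nbr6; lia.
  by have [_ Ml _] := A_edge Ail; have := imax i.+1; rewrite Ml; lia.
have nbr0 l : A 0 l -> l = K + 12 \/ l = i.
  by apply: saturated => //; [exact: A_sym | lia].
(* Now [0] is saturated by [K + 12] and [i], so no gap vertex below [i] can leave the path. *)
have down d : 6 + d <= i -> A (i - d) (i - d).-1.
  elim: d => [|d IH] led; first by rewrite subn0.
  have [_ Mj _] := A_edge (IH (ltnW led)).
  rewrite subnS; have [] // := @forced (i - d).-1 (i - d).-2 (i - d) Mj.
  have gap_j : 6 <= (i - d).-1 < K + 6 by lia.
  move=> l Al; case: (nbr_gap gap_j Al) => [l0||]; try lia.
  by subst l; move: (nbr0 _ (A_sym Al)); lia.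
have A56 : A 5 6.
  by have := down (i - 6); rewrite subKn; [move=> A65; apply/A_sym/A65; lia | lia].
have nbr5 l : A 5 l -> l = K + 12 \/ l = 6 by apply: saturated => //; lia.
pose Q l := [\/ l = 0, l = 5, l = K + 12 | 6 <= l < K + 6].
suff : Q 1 by case; lia.
apply: (@A_closed Q 0); [by apply: M_short; left | exact: Or41 | | by apply: M_short; left].
rewrite /Q => j k [->|->|->|gap_j] Ajk.
- by case: (nbr0 _ Ajk) => ->; [exact: Or43 | exact: Or44].
- by case: (nbr5 _ Ajk) => ->; [exact: Or43 | apply: Or44; lia].
- have [_ _] := A_edge Ajk; rewrite /nat_edge /half_edge => e.
  by have [->|/eqP k0] := eqVneq k 0; [exact: Or41 | apply: Or42; lia].
have k6 : k <> K + 6.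
  by move=> ek; subst k; move: (nbr6 _ (A_sym Ajk)); lia.
have [->|/eqP k5] := eqVneq k 5; first exact: Or42.
by case: (nbr_gap gap_j Ajk) => ek; [exact: Or41 | |]; apply: Or44; lia.
Qed.

End GapFilling.

(** The short cycle misses only gap vertices, so the extra vertex [z] lies in the gap and
    [gap_filled] applies. *)
Lemma gap_graph_extension K (c c' : seq (gap_graph K)) :
  map (@nat_of_ord _) c = short_cycle K -> is_cycle c' ->
  cycle_vertices c \proper cycle_vertices c' -> cycle_vertices c' = [set: gap_graph K].
Proof.
move=> def_c cyc' /properP[/subsetP sub [z]]; rewrite !inE => zc' zc.
have mem_c (i : 'I_(K + 13)) : (i \in c) = (nat_of_ord i \in short_cycle K).
  by rewrite -def_c (mem_map (@ord_inj _)).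
pose M := [pred i | i \in map (@nat_of_ord (K + 13)) c'].
pose A i j := exists x y : 'I_(K + 13),
  [/\ nat_of_ord x = i, nat_of_ord y = j & @cycle_adj (gap_graph K) c' x y].
have gap_z : 6 <= nat_of_ord z < K + 6.
  by move: zc; rewrite mem_c /short_cycle !inE; move: (ltn_ord z); lia.
suff fill i : i < K + 13 -> M i.
  by apply/setP=> x; rewrite !inE -(mem_map (@ord_inj _)); apply: (fill _ (ltn_ord x)).
apply: (@gap_filled K M A _ _ _ _ _ z) => //.
- by move=> _ _ [x [y [<- <- xy]]]; exists y, x; split=> //; apply: cycle_adj_sym.
- move=> _ _ [x [y [<- <- xy]]]; have [xc yc e] := cycle_adjP cyc' xy.
  by split=> //; rewrite /M inE (mem_map (@ord_inj _)).
- move=> _ /mapP[x xc ->]; have [y [t [yt xy xt only]]] := cycle_adj_two cyc' xc.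
  exists (nat_of_ord y), (nat_of_ord t); split; [by move/val_inj | by exists x, y | by exists x, t |].
  by move=> _ [x' [u [/val_inj-> <- xu]]]; case: (only _ xu) => ->; [left | right].
- move=> Q _ /mapP[x xc ->] Qx Qcl _ /mapP[y yc ->].
  apply: (cycle_adj_closed cyc' (Q := fun x : 'I_(K + 13) => Q x) xc Qx) => // u v Qu uv.
  by apply: Qcl Qu _; exists u, v.
- move=> j short_j; have ltj : j < K + 13 by lia.
  have := sub (Ordinal ltj); rewrite !inE mem_c /short_cycle !inE /=.
  by rewrite /M /= (mem_map (@ord_inj _) c' (Ordinal ltj)); apply; lia.
- by rewrite /M inE (mem_map (@ord_inj _)).
Qed.

Theorem theorem3p5 (S : {fset nat}) :
  S <> fset0 ->
  (forall s : nat, s \in S -> 0 < s) ->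
  exists G : nat -> sgraph,
    (forall m n : nat, m <> n -> ~ isomorphic (G m) (G n)) /\
    (forall n : nat,
      [/\ connected_graph (G n), chordal (G n), hamiltonian (G n)
        & ~ S_cycle_extendible (G n) S]).
Proof.
(* [K n] exceeds every element of [S], so any [s] in [S] leaves room for an extension; the summand
   [n] separates the orders. *)
move=> S0 _; pose K n := (\max_(s <- S) s).+1 + n.
have ltK s n : s \in S -> s < K n.
  by move=> sS; rewrite /K addSn ltnS; apply/(leq_trans _ (leq_addr _ _))/leq_bigmax_seq.
exists (fun n => gap_graph (K n)); split=> [m n mn [f /bij_eq_card]|n].
  by rewrite !card_ord /K; lia.
split; [|exact: gap_graph_chordal | exact: gap_graph_hamiltonian |].
  have [c [/andP[cC _] _] /setP all_c] := gap_graph_hamiltonian (K n).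
  by move=> x y; apply: (connect_cycle cC); have := all_c x; have := all_c y; rewrite !inE.
have [c cyc def_c] := gap_graph_short_cycle (K n).
have card_c : #|cycle_vertices c| = 13.
  have [/andP[_ cU] _] := cyc; rewrite cardsE (card_uniqP cU).
  by rewrite -(size_map (@nat_of_ord _)) def_c.
move=> /(_ c cyc)[|c' [cyc' sub]].
  have [s sS] : exists s, s \in S.
    by apply/fset0Pn/eqP.
  by exists s => //; rewrite card_c card_ord; have := ltK s n sS; lia.
(* Every extension adds exactly [K n] vertices, too many to be in [S]. *)
rewrite (gap_graph_extension def_c cyc' sub) cardsT card_ord card_c addnK.
by move/(ltK _ n); rewrite ltnn.
Qed.
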